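(* Let $G=(V,E)$ be a locally finite (unweighted) graph. For any pair of neighboring vertices $x\sim y$, let $\sharp(x,y)$ denote the number of triangles which include $x,y$ as vertices, i.e. $\sharp(x,y)=\sum_{x_1:\,x_1\sim x,\ x_1\sim y}1$. Then for every pair of neighboring vertices $x,y$, $$\kappa(x,y)\geq-\left(1-\frac{1}{d_x}-\frac{1}{d_y}-\frac{\sharp(x,y)}{d_x\wedge d_y}\right)_+-\left(1-\frac{1}{d_x}-\frac{1}{d_y}-\frac{\sharp(x,y)}{d_x\vee d_y}\right)_++\frac{\sharp(x,y)}{d_x\vee d_y}.$$ Moreover, this inequality is sharp for certain graphs, i.e. there exist a locally finite graph and neighboring vertices $x,y$ in it for which equality holds.
   Context: Graphs $G=(V,E)$ are undirected, connected, simple, without loops; $V$ may be infinite; locally finite means every vertex has finitely many neighbors. $x\sim y$ means $x,y$ are neighbors, and $d_x$ is the degree (number of neighbors) of $x$. $d$ is the graph distance (number of edges of a shortest path). For each vertex $x$, $m_x$ is the probability measure on $V$ with $m_x(y)=1/d_x$ if $y\sim x$ and $m_x(y)=0$ otherwise. $W_1(\mu_1,\mu_2)=\inf_\xi\sum_{x',y'}d(x',y')\xi(x',y')$, the infimum over all probability measures $\xi$ on $V\times V$ with marginals $\mu_1$ and $\mu_2$. The Ollivier-Ricci curvature is $\kappa(x,y)=1-\frac{W_1(m_x,m_y)}{d(x,y)}$ for $x\ne y$; thus $\kappa(x,y)=1-W_1(m_x,m_y)$ when $x\sim y$. Notation: $s_+=\max(s,0)$, $s\vee t=\max(s,t)$,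 $s\wedge t=\min(s,t)$. *)

(* Defs.v *)
From mathcomp Require Import all_boot all_order all_algebra.
From mathcomp Require Import finmap.
From mathcomp Require Import all_classical all_reals all_analysis.

Set Implicit Arguments.
Unset Strict Implicit.
Unset Printing Implicit Defensive.

Import Order.TTheory GRing.Theory Num.Theory.
Local Open Scope classical_set_scope.
Local Open Scope ring_scope.

(* The vertex set may be infinite; local finiteness is a separate predicate. *)
Record graph := Graph {
  vertex :> choiceType;
  adj : rel vertex;
  adj_sym : symmetric adj;
  adj_irrefl : irreflexive adj;
  adj_connected : forall x y : vertex, exists2 p, path adj x p & last x p = y }.

Section Graph.
Variable G : graph.
Implicit Types x y z : G.

Definition nbhd x : set G := [set y | adj x y].

(* [degree] and [triangles] are meaningful for locally finite graphs only:
   [fset_set] sends infinite sets to the empty finite set. *)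
Definition locally_finite := forall x, finite_set (nbhd x).

Definition degree x : nat := #|` fset_set (nbhd x)|%fset.

Definition triangles x y : nat :=
  #|` fset_set [set z | adj z x /\ adj z y]|%fset.

Definition walk_of_length x y (n : nat) : Prop :=
  exists p : seq G, [/\ path (@adj G) x p, last x p = y & size p = n].

Lemma walk_ex x y : exists n, `[< walk_of_length x y n >].
Proof.
by have [p px py] := adj_connected x y; exists (size p); apply/asboolP; exists p.
Qed.

Definition gdist x y : nat := ex_minn (walk_ex x y).

End Graph.

(* On a discrete space a probability measure is given by its mass function,
   and "W1" is valued in \bar R so that no convergence is presupposed. *)
Definition is_prob (R : realType) (T : choiceType) (mu : T -> R) : Prop :=
  (forall t, 0 <= mu t) /\ \esum_(t in [set: T]) (mu t)%:E = 1%E.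

Definition coupling (R : realType) (G : graph) (mu nu : G -> R)
    (xi : G * G -> R) : Prop :=
  [/\ is_prob xi,
      forall x, \esum_(y in [set: G]) (xi (x, y))%:E = (mu x)%:E
    & forall y, \esum_(x in [set: G]) (xi (x, y))%:E = (nu y)%:E].

Definition W1 (R : realType) (G : graph) (mu nu : G -> R) : \bar R :=
  ereal_inf [set \esum_(p in [set: G * G]) ((gdist p.1 p.2)%:R * xi p)%:E
            | xi in coupling mu nu].

Definition walk_measure (R : realType) (G : graph) (x y : G) : R :=
  if adj x y then (degree x)%:R^-1 else 0.

(* Meaningful for [x <> y] only. *)
Definition ollivier_curvature (R : realType) (G : graph) (x y : G) : \bar R :=
  (1 - W1 (@walk_measure R G x) (@walk_measure R G y)
       / ((gdist x y)%:R)%:E)%E.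

Definition curvature_bound (R : realType) (G : graph) (x y : G) : R :=
  let dx : R := (degree x)%:R in
  let dy : R := (degree y)%:R in
  let t : R := (triangles x y)%:R in
  - Num.max (1 - 1 / dx - 1 / dy - t / Num.min dx dy) 0
  - Num.max (1 - 1 / dx - 1 / dy - t / Num.max dx dy) 0
  + t / Num.max dx dy.

(* Main.v *)
Require Import Defs.
From mathcomp Require Import all_boot all_order all_algebra.
From mathcomp Require Import finmap.
From mathcomp Require Import all_classical all_reals all_analysis.
From mathcomp Require Import ring lra.

Set Implicit Arguments.
Unset Strict Implicit.
Unset Printing Implicit Defensive.

Import Order.TTheory GRing.Theory Num.Theory.
Local Open Scope classical_set_scope.
Local Open Scope ring_scope.

(** An upper bound on the transport distance is a transport plan. Write [a] and
    [b] for the degrees of the ends of the edge [xy], with [a <= b], and [t] for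
    the number of triangles. Both measures have mass at least [1 / b] at
    each common neighbor of [x] and [y], and the plan leaves that mass in place.
    The remaining mass [1 - t / b] goes to [x], which can take [1 / b], and to the
    neighbors of [y] that are neither [x] nor adjacent to [x]. It comes from the
    neighbors of [x] alone, from the surplus at the common neighbors, and from
    [y]. All of these are at distance 1 from [x], and at distance at most 3, 2
    and 1 from the other targets. The capacity of [x] is therefore given to the
    far sources first. The mass of the far sources that does not fit into [x] is
    [max (1 - 1/a - 1/b - t/a) 0], and that of the far and common sources
    together is [max (1 - 1/a - 1/b - t/b) 0]; each overflow costs one extra
    unit of distance per unit of mass, so the total cost is exactly 1 minus the
    curvature bound. [greedy_filling] computes the overflows, and
    [walk_measures_transportable] assembles the plan from independent pieces
    ([transportable_prod]).

    For sharpness a single edge suffices: its bound is 0, and mutually singular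
    measures are at transport distance at least 1 ([W1_ge1_singular]), so its
    curvature is at most 0. *)

(** * Graph distance *)

Lemma gdist_le_walk (G : graph) (x y : G) n :
  walk_of_length x y n -> (gdist x y <= n)%N.
Proof.
by rewrite /gdist; case: ex_minnP => m _ min_m w; apply/min_m/asboolP.
Qed.

Lemma gdist_walk (G : graph) (x y : G) : walk_of_length x y (gdist x y).
Proof. by rewrite /gdist; case: ex_minnP => m /asboolP. Qed.

Lemma gdist_refl (G : graph) (x : G) : gdist x x = 0%N.
Proof. by apply/eqP; rewrite -leqn0; apply: gdist_le_walk; exists [::]. Qed.

Lemma gdist_gt0 (G : graph) (x y : G) : x != y -> (0 < gdist x y)%N.
Proof.
move=> neq_xy; rewrite lt0n; apply: contraNneq neq_xy => d0.
by have [[|z p] [_ /= e]] := gdist_walk x y; rewrite d0 // e.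
Qed.

Lemma gdist_le_rev (G : graph) (x y : G) : (gdist y x <= gdist x y)%N.
Proof.
have [p [path_p last_p size_p]] := gdist_walk x y.
apply: gdist_le_walk; exists (rev (belast x p)); split.
- rewrite -last_p rev_path (eq_path (e' := @adj G)) // => u v.
  exact: adj_sym.
- by case: p path_p last_p size_p => //= z p *; rewrite rev_cons last_rcons.
- by rewrite size_rev size_belast.
Qed.

Lemma gdist_sym (G : graph) (x y : G) : gdist x y = gdist y x.
Proof. by apply/eqP; rewrite eqn_leq !gdist_le_rev. Qed.

Lemma gdist_adj_le1 (G : graph) (x y : G) : adj x y -> (gdist x y <= 1)%N.
Proof. by move=> xy; apply: gdist_le_walk; exists [:: y]; rewrite /= xy. Qed.

Lemma adj_neq (G : graph) (x y : G) : adj x y -> x != y.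
Proof. by apply: contraTneq => ->; rewrite adj_irrefl. Qed.

Lemma gdist_adj (G : graph) (x y : G) : adj x y -> gdist x y = 1%N.
Proof.
move=> xy; apply/eqP.
by rewrite eqn_leq gdist_adj_le1 //= gdist_gt0 // adj_neq.
Qed.

Lemma gdist_triangle (G : graph) (x y z : G) :
  (gdist x z <= gdist x y + gdist y z)%N.
Proof.
have [p [px py sp]] := gdist_walk x y.
have [q [qy qz sq]] := gdist_walk y z.
apply: gdist_le_walk; exists (p ++ q).
by rewrite cat_path last_cat px py qy size_cat sp sq.
Qed.

(** * Finitely supported transport plans *)

Lemma esum_finsupp (R : realType) (T : choiceType) (S : {fset T}) (f : T -> R) :
  (forall t, 0 <= f t) -> (forall t, t \notin S -> f t = 0) ->
  \esum_(t in [set: T]) (f t)%:E = (\sum_(t <- S) f t)%:E.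
Proof.
move=> f_ge0 f_supp.
transitivity (\esum_(t in [set` S]) (f t)%:E).
  rewrite [RHS]esum_mkcond; apply: eq_esum => t _.
  by rewrite mem_setE; case: ifPn => // /f_supp ->.
rewrite esum_fset //; last by move=> t _; rewrite lee_fin.
by rewrite fsbig_finite // set_fsetK sumEFin.
Qed.

(** The total mass is left free so that plans can be superposed, and the cost is
    only bounded above so that distances may be overestimated. *)
Definition transportable (R : realType) (G : graph) (S : {fset G})
    (mu nu : G -> R) (c : R) : Prop :=
  exists xi : G -> G -> R,
    [/\ forall u v, 0 <= xi u v,
        forall u v, ~~ ((u \in S) && (v \in S)) -> xi u v = 0,
        forall u, \sum_(v <- S) xi u v = mu u,
        forall v, \sum_(u <- S) xi u v = nu v
      & \sum_(u <- S) \sum_(v <- S) (gdist u v)%:R * xi u v <= c].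

Lemma transportable_sym (R : realType) (G : graph) (S : {fset G})
    (mu nu : G -> R) (c : R) :
  transportable S mu nu c -> transportable S nu mu c.
Proof.
move=> [xi [xi_ge0 xi_supp xi_mu xi_nu cost]].
exists (fun u v => xi v u); split=> //.
  by move=> u v; rewrite andbC; exact: xi_supp.
rewrite exchange_big; apply: le_trans cost.
by apply: ler_sum => u _; apply: ler_sum => v _; rewrite gdist_sym.
Qed.

Lemma transportable_add (R : realType) (G : graph) (S : {fset G})
    (mu nu mu' nu' : G -> R) (c c' : R) :
  transportable S mu nu c -> transportable S mu' nu' c' ->
  transportable S (mu \+ mu') (nu \+ nu') (c + c').
Proof.
move=> [xi [xi_ge0 xi_supp xi_mu xi_nu cost]].
move=> [xi' [xi'_ge0 xi'_supp xi'_mu xi'_nu cost']].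
exists (fun u v => xi u v + xi' u v); split.
- by move=> u v; rewrite addr_ge0.
- by move=> u v uvS; rewrite xi_supp // xi'_supp // addr0.
- by move=> u; rewrite big_split xi_mu xi'_mu.
- by move=> v; rewrite big_split xi_nu xi'_nu.
- under eq_bigr do (under eq_bigr do rewrite mulrDr; rewrite big_split).
  by rewrite big_split lerD.
Qed.

Lemma sum_pred1_fset (R : realType) (T : choiceType) (S : {fset T}) (t : T)
    (f : T -> R) :
  t \in S -> \sum_(u <- S) f u *+ (u == t) = f t.
Proof.
move=> tS; rewrite (big_fsetD1 t) //= eqxx big1_seq ?addr0 // => u.
by rewrite !inE => /= /andP[/negbTE ->].
Qed.

Lemma transportable_refl (R : realType) (G : graph) (S : {fset G})
    (mu : G -> R) :
  (forall u, 0 <= mu u) -> (forall u, u \notin S -> mu u = 0) ->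
  transportable S mu mu 0.
Proof.
move=> mu_ge0 mu_supp.
have sumE u : \sum_(v <- S) mu v *+ (v == u) = mu u.
  have [uS|uS] := boolP (u \in S); first exact: sum_pred1_fset.
  rewrite mu_supp // big1_seq // => v /= vS.
  by case: eqP => // e; rewrite -e vS in uS.
exists (fun u v => mu v *+ (v == u)); split => //.
- by move=> u v; rewrite mulrn_wge0.
- by move=> u v; case: eqP => // ->; rewrite andbb; exact: mu_supp.
- move=> v; rewrite -[RHS]sumE; apply: eq_bigr => u _.
  by rewrite eq_sym; case: eqP => // ->.
- rewrite big1 // => u _; rewrite big1 // => v _.
  by case: eqP => [->|]; rewrite ?gdist_refl ?mul0r ?mulr0.
Qed.

(** A zero total is harmless, since [f] then vanishes. *)
Lemma mulf_total_massK (R : realType) (T : choiceType) (S : {fset T})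
    (f : T -> R) t :
  (forall u, 0 <= f u) -> (forall u, u \notin S -> f u = 0) ->
  f t * (\sum_(u <- S) f u) / (\sum_(u <- S) f u) = f t.
Proof.
move=> f_ge0 f_supp.
have [tS|/f_supp ->] := boolP (t \in S); last by rewrite !mul0r.
have f_le : f t <= \sum_(u <- S) f u.
  by rewrite (big_fsetD1 t) //= lerDl sumr_ge0.
have [M0|M_neq0] := eqVneq (\sum_(u <- S) f u) 0; last by rewrite mulfK.
by apply/eqP; rewrite M0 mulr0 mul0r eq_le f_ge0 -M0 f_le.
Qed.

(** The independent plan [mu u * nu v / M], where [M] is the common mass. It
    also covers [M = 0]: both measures then vanish, and so does the plan. The
    cost is controlled source by source, [c u] bounding the cost of moving all
    the mass at [u] to any point that receives mass. *)
Lemma transportable_prod (R : realType) (G : graph) (S : {fset G})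
    (mu nu c : G -> R) :
  (forall u, 0 <= mu u) -> (forall u, u \notin S -> mu u = 0) ->
  (forall v, 0 <= nu v) -> (forall v, v \notin S -> nu v = 0) ->
  \sum_(u <- S) mu u = \sum_(v <- S) nu v ->
  (forall u, 0 <= c u) ->
  (forall u v, nu v != 0 -> (gdist u v)%:R * mu u <= c u) ->
  transportable S mu nu (\sum_(u <- S) c u).
Proof.
move=> mu_ge0 mu_supp nu_ge0 nu_supp mass c_ge0 cost.
set M := \sum_(v <- S) nu v in mass.
have M_ge0 : 0 <= M by rewrite sumr_ge0.
exists (fun u v => mu u * nu v / M); split.
- by move=> u v; rewrite divr_ge0 // mulr_ge0.
- move=> u v; rewrite negb_and => /orP[/mu_supp ->|/nu_supp ->].
    by rewrite !mul0r.
  by rewrite mulr0 mul0r.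
- move=> u; rewrite -mulr_suml -mulr_sumr -/M -mass.
  exact: mulf_total_massK.
- move=> v; rewrite -mulr_suml -mulr_suml mass mulrC [M * _]mulrC mulrC.
  exact: mulf_total_massK.
- apply: ler_sum => u _.
  apply: (@le_trans _ _ (\sum_(v <- S) c u * nu v / M)).
    apply: ler_sum => v _; rewrite !mulrA ler_wpM2r ?invr_ge0 //.
    have [->|nu_neq0] := eqVneq (nu v) 0; first by rewrite !mulr0.
    by rewrite ler_wpM2r // cost.
  rewrite -mulr_suml -mulr_sumr -/M -mulrA ler_piMr //.
  have [->|M_neq0] := eqVneq M 0; first by rewrite mul0r.
  by rewrite divff.
Qed.

Lemma W1_le_transportable (R : realType) (G : graph) (S : {fset G})
    (mu nu : G -> R) (c : R) :
  \sum_(u <- S) mu u = 1 -> transportable S mu nu c ->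
  (W1 mu nu <= c%:E)%E.
Proof.
move=> mu1 [xi [xi_ge0 xi_supp xi_mu xi_nu cost]].
have rowE u (f : G -> R) : (forall v, 0 <= f v) ->
    \esum_(v in [set: G]) (f v * xi u v)%:E = (\sum_(v <- S) f v * xi u v)%:E.
  move=> f_ge0; apply: esum_finsupp => [v|v vS]; first by rewrite mulr_ge0.
  by rewrite xi_supp ?mulr0 // negb_and vS orbT.
have pairE (f : G -> G -> R) : (forall u v, 0 <= f u v) ->
    \esum_(p in [set: G * G]) (f p.1 p.2 * xi p.1 p.2)%:E =
    (\sum_(u <- S) \sum_(v <- S) f u v * xi u v)%:E.
  move=> f_ge0; have -> : [set: G * G] = [set: G] `*`` (fun=> [set: G]).
    by apply/seteqP; split.
  rewrite -(@esum_esum _ _ _ _ _ (fun u v => (f u v * xi u v)%:E)); last first.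
    by move=> u v _ _; rewrite lee_fin mulr_ge0.
  under eq_esum do rewrite rowE //.
  rewrite (esum_finsupp (S := S)) // => [u|u uS].
    by apply: sumr_ge0 => v _; rewrite mulr_ge0.
  by apply: big1 => v _; rewrite xi_supp ?mulr0 // negb_and uS.
apply: (@le_trans _ _
  (\sum_(u <- S) \sum_(v <- S) (gdist u v)%:R * xi u v)%:E);
  last by rewrite lee_fin.
apply: ereal_inf_lbound => /=; exists (fun p => xi p.1 p.2); last exact: pairE.
split=> /=.
- split=> [p //|]; have := @pairE (fun _ _ => 1) (fun _ _ => ler01).
  under eq_esum do rewrite mul1r; move=> ->.
  under eq_bigr do (under eq_bigr do rewrite mul1r; rewrite xi_mu).
  by rewrite mu1.
- move=> u; have := @rowE u (fun=> 1) (fun _ => ler01).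
  under eq_esum do rewrite mul1r; move=> ->.
  by under eq_bigr do rewrite mul1r; rewrite xi_mu.
- move=> v; rewrite (esum_finsupp (S := S)) ?xi_nu // => u uS.
  by rewrite xi_supp // negb_and uS.
Qed.

(** * Lower bound on the transport distance *)

Lemma term_le_esum (R : realType) (T : choiceType) (f : T -> R) (t : T) :
  (forall u, 0 <= f u) -> ((f t)%:E <= \esum_(u in [set: T]) (f u)%:E)%E.
Proof.
move=> f_ge0; rewrite -(@esum_set1 _ _ t (fun u => (f u)%:E)) ?lee_fin //.
by rewrite esum_mkcond; apply: le_esum => u _; case: ifP => //; rewrite lee_fin.
Qed.

(** Mass that must leave every point where it sits travels at distance at
    least one. *)
Lemma W1_ge1_singular (R : realType) (G : graph) (mu nu : G -> R) :
  (forall u, mu u = 0 \/ nu u = 0) -> (1 <= W1 mu nu)%E.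
Proof.
move=> singular; apply: le_ereal_inf_tmp.
move=> _ [xi [[xi_ge0 xi1] xi_mu xi_nu] <-].
rewrite -xi1; apply: le_esum => -[u v] _; rewrite lee_fin /=.
have [<-|neq_uv] := eqVneq u v; last first.
  by rewrite ler_peMl // ler1n gdist_gt0.
suff : ((xi (u, u))%:E <= 0)%E.
  by rewrite lee_fin => /le_trans -> //; rewrite mulr_ge0.
case: (singular u) => z0.
- have -> : 0%E = (mu u)%:E by rewrite z0.
  rewrite -xi_mu; exact: (@term_le_esum _ _ (fun v => xi (u, v))).
- have -> : 0%E = (nu u)%:E by rewrite z0.
  rewrite -xi_nu; exact: (@term_le_esum _ _ (fun v => xi (v, u))).
Qed.

(** * The neighborhoods of an edge *)

Lemma in_nbhd_fset (G : graph) (x u : G) :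
  locally_finite G -> (u \in fset_set (nbhd x)) = adj x u.
Proof.
by move=> lf; rewrite in_fset_set //; apply/idP/idP; rewrite inE.
Qed.

Lemma triangles_fsetI (G : graph) (x y : G) : locally_finite G ->
  triangles x y = #|` fset_set (nbhd x) `&` fset_set (nbhd y)|%fset.
Proof.
move=> lf; rewrite -fset_setI //; congr #|` fset_set _|%fset.
by apply/seteqP; split => z [] /=; rewrite [adj z x]adj_sym [adj z y]adj_sym.
Qed.

Lemma triangles_sym (G : graph) (x y : G) : triangles x y = triangles y x.
Proof.
congr #|` fset_set _|%fset.
by apply/seteqP; split => z [].
Qed.

Lemma triangles_lt_degree (G : graph) (x y : G) : locally_finite G ->
  adj x y -> (triangles x y < degree x)%N.
Proof.
move=> lf xy; rewrite triangles_fsetI // /degree.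
rewrite (cardfsD1 y (fset_set (nbhd x))) in_nbhd_fset // xy ltnS.
apply: fsubset_leq_card; apply/fsubsetP => u.
rewrite !inE !in_nbhd_fset // => /andP[-> yu].
by rewrite eq_sym adj_neq.
Qed.

(** The edge [xy] cuts the neighbors of [x] into those private to [x], those
    shared with [y], and [y] itself. The walk measures and every part into which
    the plan splits them are constant on these three classes, so that sums
    depend only on the two degrees and the number of triangles. *)
Definition edge_density (R : realType) (G : graph) (x y : G) (a b c : R)
    (u : G) : R :=
  if ~~ adj x u then 0 else if u == y then c else if adj y u then b else a.

Lemma edge_density_ge0 (R : realType) (G : graph) (x y : G) (a b c : R) u :
  0 <= a -> 0 <= b -> 0 <= c -> 0 <= edge_density x y a b c u.
Proof. by rewrite /edge_density; do !case: ifP. Qed.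

Lemma sum_const_fset (R : realType) (T : choiceType) (F : {fset T}) (a : R) :
  \sum_(u <- F) a = a * (#|` F|)%:R.
Proof. by rewrite big_const_seq count_predT iter_addr_0 mulr_natr. Qed.

Lemma sum_edge_density (R : realType) (G : graph) (x y : G) (S : {fset G})
    (a b c : R) :
  locally_finite G -> adj x y -> (fset_set (nbhd x) `<=` S)%fset ->
  \sum_(u <- S) edge_density x y a b c u =
  a * ((degree x)%:R - (triangles x y)%:R - 1) + b * (triangles x y)%:R + c.
Proof.
move=> lf xy NS; set N := fset_set (nbhd x) in NS *.
rewrite -(big_fset_incl _ NS) /=; last first.
  by move=> u _; rewrite /edge_density in_nbhd_fset // => ->.
set T := (N `&` fset_set (nbhd y))%fset.
have sumT : \sum_(u <- N) (b - a) *+ (u \in T) = (b - a) * (triangles x y)%:R.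
  rewrite -(big_fset_incl _ (fsubsetIl N (fset_set (nbhd y)))) /=; last first.
    by move=> u _ /negbTE ->.
  rewrite triangles_fsetI // -sum_const_fset.
  by apply: eq_big_seq => u /= ->.
transitivity (\sum_(u <- N) (a + (b - a) *+ (u \in T) + (c - a) *+ (u == y))).
  apply: eq_big_seq => u; rewrite /T inE /= !in_nbhd_fset // => xu.
  rewrite /edge_density xu /=.
  have [->|_] := eqVneq u y; first by rewrite adj_irrefl /=; ring.
  by case: ifP => _ /=; ring.
rewrite !big_split /= sum_const_fset sumT sum_pred1_fset ?in_nbhd_fset //.
by rewrite /degree -/N; ring.
Qed.

Lemma sum_walk_measure (R : realType) (G : graph) (x y : G) (S : {fset G}) :
  locally_finite G -> adj x y -> (fset_set (nbhd x) `<=` S)%fset ->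
  \sum_(u <- S) walk_measure R x u = 1.
Proof.
move=> lf xy NS; rewrite -(big_fset_incl _ NS) /=; last first.
  by move=> u _; rewrite in_nbhd_fset // /walk_measure => /negbTE ->.
rewrite (eq_big_seq (fun=> (degree x)%:R^-1)).
  rewrite sum_const_fset mulVf // pnatr_eq0 -lt0n.
  exact: leq_ltn_trans (triangles_lt_degree lf xy).
by move=> u; rewrite /= in_nbhd_fset // /walk_measure => ->.
Qed.

(** * Transport across an edge *)

Lemma scale_down (R : realType) (r m : R) : 0 <= m <= r ->
  exists2 s : R, 0 <= s <= 1 & s * r = m.
Proof.
move=> /andP[m_ge0 m_le]; have [r0|r_neq0] := eqVneq r 0.
  by exists 0; [rewrite lexx ler01|lra].
have r_gt0 : 0 < r by rewrite lt_def r_neq0 (le_trans m_ge0).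
exists (m / r); last by rewrite divfK.
by rewrite divr_ge0 ?(ltW r_gt0) //= ler_pdivrMr // mul1r.
Qed.

(** A sink of capacity [q] is filled from three reservoirs, giving [ra] priority
    over [rb] and [rb] over [rc]. What is left in the first reservoir, and in
    the first two together, is then as small as possible: these overflows are
    the two positive parts of the curvature bound. *)
Lemma greedy_filling (R : realType) (ra rb rc q : R) :
  0 <= ra -> 0 <= rb -> 0 <= rc -> 0 <= q <= ra + rb + rc ->
  exists s1 s2 s3 : R,
    [/\ 0 <= s1 <= 1, 0 <= s2 <= 1, 0 <= s3 <= 1,
        s1 * ra + s2 * rb + s3 * rc = q
      & (1 - s1) * ra = Num.max (ra - q) 0 /\
        (1 - s1) * ra + (1 - s2) * rb = Num.max (ra + rb - q) 0].
Proof.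
move=> ra_ge0 rb_ge0 rc_ge0 /andP[q_ge0 q_le].
have [s1 s1_01 e1] : exists2 s : R, 0 <= s <= 1 & s * ra = Num.min ra q.
  by apply: scale_down; rewrite le_min ra_ge0 q_ge0 ge_min lexx.
have [s2 s2_01 e2] : exists2 s : R, 0 <= s <= 1 &
    s * rb = Num.min (ra + rb) q - Num.min ra q.
  apply: scale_down; apply/andP.
  by case: (leP ra q); case: (leP (ra + rb) q); lra.
have [s3 s3_01 e3] : exists2 s : R, 0 <= s <= 1 &
    s * rc = q - Num.min (ra + rb) q.
  by apply: scale_down; apply/andP; case: (leP (ra + rb) q); lra.
exists s1, s2, s3; split=> //; first lra.
rewrite !mulrBl !mul1r e1 e2.
split; first by case: (leP ra q); case: (leP (ra - q) 0); lra.
have -> : ra - Num.min ra q + (rb - (Num.min (ra + rb) q - Num.min ra q)) =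
  ra + rb - Num.min (ra + rb) q by ring.
by case: (leP (ra + rb) q); case: (leP (ra + rb - q) 0); lra.
Qed.

(** Mass [1 / degree y] stays at each common neighbor. What remains starts from
    the private neighbors of [x], from the surplus at the common ones and from
    [y], and has to end at [x] or at a private neighbor of [y]. Every source is
    at distance 1 from [x], but at distance up to 3, 2 and 1 respectively from
    the private neighbors of [y]; hence [x] should be served by the private
    neighbors first and by [y] last. The assumption on the degrees makes the
    surplus at the common neighbors nonnegative. *)
Lemma walk_measures_transportable (R : realType) (G : graph) (x y : G) :
  locally_finite G -> adj x y -> (degree x <= degree y)%N ->
  transportable (fset_set (nbhd x) `|` fset_set (nbhd y))%fset
    (walk_measure R x) (walk_measure R y) (1 - curvature_bound R x y).
Proof.
move=> lf xy le_deg; set S := (_ `|` _)%fset.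
have yx : adj y x by rewrite adj_sym.
have Sx : (fset_set (nbhd x) `<=` S)%fset by apply: fsubsetUl.
have Sy : (fset_set (nbhd y) `<=` S)%fset by apply: fsubsetUr.
have t_lt := triangles_lt_degree lf xy.
set t : R := (triangles x y)%:R.
set dx : R := (degree x)%:R; set dy : R := (degree y)%:R.
pose p := dx^-1; pose q := dy^-1.
have t_ge0 : 0 <= t by apply: ler0n.
have t_dx : t + 1 <= dx by rewrite natr1 ler_nat.
have dx_dy : dx <= dy by rewrite ler_nat.
have pdx : p * dx = 1 by rewrite mulVf //; lra.
have qdy : q * dy = 1 by rewrite mulVf //; lra.
have q_ge0 : 0 <= q by rewrite invr_ge0 ler0n.
have q_le_p : q <= p by rewrite lef_pV2 ?posrE //; lra.
have p_ge0 := le_trans q_ge0 q_le_p.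
have q_mass : q * (t + 1) <= 1 by rewrite -qdy ler_wpM2l //; lra.
have [s1 [s2 [s3 [/andP[s1_ge0 s1_le1] /andP[s2_ge0 s2_le1]
    /andP[s3_ge0 s3_le1] filled [left_a left_ab]]]]] : exists s1 s2 s3 : R,
    [/\ 0 <= s1 <= 1, 0 <= s2 <= 1, 0 <= s3 <= 1,
        s1 * (p * (dx - t - 1)) + s2 * ((p - q) * t) + s3 * p = q
      & (1 - s1) * (p * (dx - t - 1)) = Num.max (p * (dx - t - 1) - q) 0 /\
        (1 - s1) * (p * (dx - t - 1)) + (1 - s2) * ((p - q) * t) =
        Num.max (p * (dx - t - 1) + (p - q) * t - q) 0].
  (* [x] is the sink, of capacity [q]; the reservoirs are the total masses
     available on the three classes. *)
  apply: greedy_filling => //.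
  - by rewrite mulr_ge0 //; lra.
  - by rewrite mulr_ge0 //; lra.
  - by rewrite q_ge0; lra.
pose stay : G -> R := edge_density x y 0 q 0.
pose to_x : G -> R := edge_density x y (s1 * p) (s2 * (p - q)) (s3 * p).
pose to_rest : G -> R :=
  edge_density x y ((1 - s1) * p) ((1 - s2) * (p - q)) ((1 - s3) * p).
pose to_rest_cost : G -> R :=
  edge_density x y (3 * ((1 - s1) * p)) (2 * ((1 - s2) * (p - q)))
    ((1 - s3) * p).
have -> : walk_measure R x = stay \+ (to_x \+ to_rest).
  apply/funext => u.
  rewrite /= /stay /to_x /to_rest /walk_measure /edge_density -/p.
  case: (adj x u) => /=; last by rewrite !addr0.
  by case: (u == y); [|case: (adj y u)]; ring.
have -> : walk_measure R y =
    stay \+ (edge_density y x 0 0 q \+ edge_density y x q 0 0).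
  apply/funext => u.
  rewrite /= /stay /walk_measure /edge_density -/q.
  have [->|_] := eqVneq u x; first by rewrite yx adj_irrefl /= add0r addr0.
  have [->|_] := eqVneq u y; first by rewrite xy adj_irrefl /= !addr0.
  by case: (adj x u); case: (adj y u) => /=; ring.
have supp_x a b c u : u \notin S -> edge_density x y a b c u = 0 :> R.
  by rewrite inE !in_nbhd_fset // /edge_density negb_or => /andP[-> _].
have supp_y a b c u : u \notin S -> edge_density y x a b c u = 0 :> R.
  by rewrite inE !in_nbhd_fset // /edge_density negb_or => /andP[_ ->].
have to_x_ge0 u : 0 <= to_x u.
  by apply: edge_density_ge0; rewrite mulr_ge0 //; lra.
have to_rest_ge0 u : 0 <= to_rest u.
  by apply: edge_density_ge0; rewrite mulr_ge0 //; lra.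
have to_rest_cost_ge0 u : 0 <= to_rest_cost u.
  by apply: edge_density_ge0; rewrite !mulr_ge0 //; lra.
have -> : 1 - curvature_bound R x y =
    0 + (\sum_(u <- S) to_x u + \sum_(u <- S) to_rest_cost u).
  (* Each unit of moved mass costs 1; the overflow of the private neighbors is
     charged 2 more and that of the common ones 1 more, which is once the first
     overflow of the greedy filling plus once the second. *)
  rewrite !sum_edge_density // /curvature_bound -/t -/dx -/dy -/p -/q.
  rewrite (min_l dx_dy) (max_r dx_dy) !mul1r -/p -/q.
  have -> : 1 - p - q - t * p = p * (dx - t - 1) - q by lra.
  have -> : 1 - p - q - t * q = p * (dx - t - 1) + (p - q) * t - q.
    by lra.
  rewrite -left_a -left_ab; lra.
apply: transportable_add; last apply: transportable_add.
- apply: transportable_refl; last exact: supp_x.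
  by move=> u; apply: edge_density_ge0.
- apply: transportable_prod => //; try by [move=> u; apply: supp_x
                                          |move=> u; apply: supp_y].
  + by move=> v; apply: edge_density_ge0.
  + by rewrite !sum_edge_density // -/t -/dx; lra.
  + move=> u v; rewrite {1}/edge_density; case: ifP; rewrite ?eqxx // => _.
    have [-> _|_] := eqVneq v x; last by case: ifP; rewrite eqxx.
    have [xu|xu] := boolP (adj x u).
      by rewrite ler_piMl // lern1 gdist_adj_le1 // adj_sym.
    by rewrite /to_x /edge_density xu mulr0.
- apply: transportable_prod => //; try by [move=> u; apply: supp_x
                                          |move=> u; apply: supp_y].
  + by move=> v; apply: edge_density_ge0.
  + rewrite !sum_edge_density // -/t -/dx -/dy.
    rewrite (triangles_sym y x) -/t; lra.
  + move=> u v; rewrite {1}/edge_density.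
    case: ifP; rewrite ?eqxx // => /negbFE yv _.
    have walk_le n k :
        (gdist u y <= k)%N -> (k.+1 <= n)%N -> (gdist u v <= n)%N.
      move=> uy; apply: leq_trans; apply: leq_trans (gdist_triangle _ y _) _.
      by rewrite -addn1 leq_add ?gdist_adj_le1.
    rewrite /to_rest /to_rest_cost /edge_density; case: ifP => [_|/negbFE xu].
      by rewrite mulr0.
    have [uy|_] := eqVneq u y; last case: ifP => yu.
    * rewrite ler_piMl ?mulr_ge0 ?lern1 //; first lra.
      by apply: (walk_le _ 0%N); rewrite // uy gdist_refl.
    * rewrite ler_wpM2r ?mulr_ge0 ?ler_nat //; [lra|lra|].
      by apply: (walk_le _ 1%N); rewrite // gdist_adj_le1 // adj_sym.
    * rewrite ler_wpM2r ?mulr_ge0 ?ler_nat //; first lra.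
      apply: (walk_le _ 2%N) => //; apply: leq_trans (gdist_triangle _ x _) _.
      by apply: (@leq_add _ _ 1 1); rewrite gdist_adj_le1 // adj_sym.
Qed.

Lemma curvature_bound_sym (R : realType) (G : graph) (x y : G) :
  curvature_bound R x y = curvature_bound R y x.
Proof.
rewrite /curvature_bound triangles_sym minC [Num.max (degree x)%:R _]maxC.
by congr (- Num.max _ _ - Num.max _ _ + _); ring.
Qed.

(** The bound and transportability are symmetric, so the endpoint of smaller
    degree may be taken as the source. *)
Lemma W1_walk_measures_le (R : realType) (G : graph) (x y : G) :
  locally_finite G -> adj x y ->
  (W1 (walk_measure R x) (walk_measure R y)
     <= (1 - curvature_bound R x y)%:E)%E.
Proof.
move=> lf xy; have yx : adj y x by rewrite adj_sym.
apply: (@W1_le_transportable _ _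
  (fset_set (nbhd x) `|` fset_set (nbhd y))%fset).
  by apply: sum_walk_measure xy _ => //; apply: fsubsetUl.
case/orP: (leq_total (degree x) (degree y)) => le_deg.
  exact: walk_measures_transportable.
apply: transportable_sym; rewrite fsetUC curvature_bound_sym.
exact: walk_measures_transportable.
Qed.

Lemma curvature_adj (R : realType) (G : graph) (x y : G) : adj x y ->
  ollivier_curvature R x y =
  (1 - W1 (walk_measure R x) (walk_measure R y))%E.
Proof. by move=> xy; rewrite /ollivier_curvature gdist_adj // inve1 mule1. Qed.

Lemma curvature_bound_le (R : realType) (G : graph) (x y : G) :
  locally_finite G -> adj x y ->
  ((curvature_bound R x y)%:E <= ollivier_curvature R x y)%E.
Proof.
move=> lf xy; rewrite curvature_adj //.
have := W1_walk_measures_le R lf xy.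
have W1_ge0 : (0 <= W1 (walk_measure R x) (walk_measure R y))%E.
  apply: le_ereal_inf_tmp => _ [xi [[xi_ge0 _] _ _] <-].
  by apply: esum_ge0 => p _; rewrite lee_fin mulr_ge0.
case: (W1 _ _) W1_ge0 => [w _| |] //.
by rewrite -EFinB !lee_fin; lra.
Qed.

(** * Sharpness *)

Definition K2_adj : rel bool := fun u v => u != v.

Lemma K2_adj_sym : symmetric K2_adj.
Proof. by move=> u v; rewrite /K2_adj eq_sym. Qed.

Lemma K2_adj_irrefl : irreflexive K2_adj.
Proof. by move=> u; rewrite /K2_adj eqxx. Qed.

Lemma K2_connected u v : exists2 p, path K2_adj u p & last u p = v.
Proof.
have [<-|uv] := eqVneq u v; first by exists [::].
by exists [:: v]; rewrite //= andbT.
Qed.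

Definition K2 : graph := Graph K2_adj_sym K2_adj_irrefl K2_connected.

Lemma K2_locally_finite : locally_finite K2.
Proof. by move=> u; apply: (@finite_finset bool). Qed.

Lemma K2_degree (u : K2) : degree u = 1%N.
Proof.
rewrite /degree (_ : nbhd u = [set ~~ u]) ?fset_set1 ?cardfs1 //.
by apply/seteqP; split => v /=; rewrite /K2_adj; case: u v => [] [].
Qed.

Lemma K2_triangles (u : K2) : triangles u (~~ u) = 0%N.
Proof.
rewrite /triangles (_ : [set z | _] = set0) ?fset_set0 //.
by apply/seteqP; split => v //= []; rewrite /K2_adj; case: u v => [] [].
Qed.

Lemma K2_curvature_bound (R : realType) :
  curvature_bound R (true : K2) (false : K2) = 0.
Proof.
rewrite /curvature_bound !K2_degree (K2_triangles true) !mul0r divr1 !subr0.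
by rewrite subrr sub0r max_r ?oppr0 ?addr0 // lerN10.
Qed.

(** The two walk measures of a single edge are point masses at opposite ends, so
    that all the mass has to cross the edge. *)
Lemma K2_curvature (R : realType) :
  ollivier_curvature R (true : K2) (false : K2) = 0%E.
Proof.
apply/eqP; rewrite eq_le; apply/andP; split; last first.
  have := @curvature_bound_le R K2 true false K2_locally_finite isT.
  by rewrite K2_curvature_bound.
rewrite curvature_adj //.
have : (1 <= W1 (walk_measure R (true : K2)) (walk_measure R (false : K2)))%E.
  by apply: W1_ge1_singular => -[]; [left|right].
case: (W1 _ _) => [w| _|] //; last by rewrite /= leNye.
by rewrite -EFinB !lee_fin subr_le0.
Qed.

Theorem theorem1 (R : realType) :
  (forall G : graph, locally_finite G ->
     forall x y : G, adj x y ->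
       ((curvature_bound R x y)%:E <= ollivier_curvature R x y)%E)
  /\
  (exists G : graph, locally_finite G /\
     exists x y : G, adj x y /\
       ollivier_curvature R x y = (curvature_bound R x y)%:E).
Proof.
split; first by move=> G lf x y; exact: curvature_bound_le.
exists K2; split; first exact: K2_locally_finite.
by exists true, false; rewrite K2_curvature K2_curvature_bound.
Qed.
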